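(* (Non-isothermal tank model.) Let $V,R_s,z_0,c_v,c_p>0$ be constants with $c_p-c_v=R_s$, and set $\mu=c_p/c_v$. Let $n_\ell,n_r\ge1$, let $q_{j,\ell},T_{j,\ell}$ ($j=1,\dots,n_\ell$) and $q_{k,r}$ ($k=1,\dots,n_r$) be real-valued functions of time, and let $p,T,m$ be positive differentiable functions of time satisfying the gas equation, mass balance and energy balance $$pV=mR_sTz_0,\qquad \dot m=\sum_{j=1}^{n_\ell}q_{j,\ell}-\sum_{k=1}^{n_r}q_{k,r},\qquad \frac{d}{dt}(mc_vT)=c_p\sum_{j=1}^{n_\ell}q_{j,\ell}T_{j,\ell}-c_pT\sum_{k=1}^{n_r}q_{k,r}.$$ Then $$\dot p=\frac{R_sz_0\mu}{V}\left(\sum_{j=1}^{n_\ell}q_{j,\ell}T_{j,\ell}-\sum_{k=1}^{n_r}q_{k,r}T\right),$$ $$\dot T=\frac{R_sTz_0}{pVc_v}\left(\sum_{j=1}^{n_\ell}q_{j,\ell}\left(c_pT_{j,\ell}-c_vT\right)-R_sT\sum_{k=1}^{n_r}q_{k,r}\right).$$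
   Context: The tank has constant volume $V$; $p,T,m$ are the pressure, temperature and mass of the gas inside; $q_{j,\ell}$ and $T_{j,\ell}$ are the mass flow and temperature at inlet $j$; $q_{k,r}$ is the mass flow at outlet $k$. $R_s$ is the specific gas constant, $z_0$ the constant compressibility factor, $c_v,c_p$ the constant specific heats. The three balance equations express the paper's assumptions: perfect mixing, ideal gas equation with constant compressibility factor, negligible potential and kinetic energy, internal energy and enthalpy zero at zero Kelvin, constant specific heats, and negligible heat flux to the environment. *)

(* Defs.v *)
From HB Require Import structures.
From mathcomp Require Import all_boot all_order all_algebra.
From mathcomp Require Import all_classical all_reals all_analysis.

Set Implicit Arguments.
Unset Strict Implicit.
Unset Printing Implicit Defensive.

(* Main.v *)
Require Import Defs.
From HB Require Import structures.
From mathcomp Require Import all_boot all_order all_algebra.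
From mathcomp Require Import all_classical all_reals all_analysis.
From mathcomp Require Import ring.

Set Implicit Arguments.
Unset Strict Implicit.
Unset Printing Implicit Defensive.

Import Order.TTheory GRing.Theory Num.Theory.
Import numFieldNormedType.Exports.

Local Open Scope ring_scope.
Local Open Scope classical_set_scope.

(** The gas equation says [p] is [Rs * z0 / (V * cv)] times the internal energy [m * cv * T], so the
    energy balance gives [p'] directly, with [cp / cv = mu]. Expanding the same energy derivative by
    the product rule and removing [m'] by the mass balance leaves a linear equation for [T']. *)

Theorem mainTheorem9 (R : realType)
  (V Rs z0 cv cp mu : R)
  (V_gt0 : 0 < V) (Rs_gt0 : 0 < Rs) (z0_gt0 : 0 < z0)
  (cv_gt0 : 0 < cv) (cp_gt0 : 0 < cp)
  (cpBcv : cp - cv = Rs) (muE : mu = cp / cv)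
  (nl nr : nat) (nl_ge1 : (1 <= nl)%N) (nr_ge1 : (1 <= nr)%N)
  (I : set R) (I_open : open I) (I_itv : is_interval I)
  (ql Tl : 'I_nl -> R -> R) (qr : 'I_nr -> R -> R)
  (p T m : R -> R)
  (p_gt0 : forall t, I t -> 0 < p t)
  (T_gt0 : forall t, I t -> 0 < T t)
  (m_gt0 : forall t, I t -> 0 < m t)
  (p_diff : forall t, I t -> derivable p t 1)
  (T_diff : forall t, I t -> derivable T t 1)
  (m_diff : forall t, I t -> derivable m t 1)
  (gas_equation : forall t, I t -> p t * V = m t * Rs * T t * z0)
  (mass_balance : forall t, I t ->
     m^`() t = (\sum_(j < nl) ql j t) - (\sum_(k < nr) qr k t))
  (energy_balance : forall t, I t ->
     (fun s => m s * cv * T s)^`() t =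
       cp * (\sum_(j < nl) ql j t * Tl j t)
       - cp * T t * (\sum_(k < nr) qr k t)) :
  forall t, I t ->
    p^`() t = Rs * z0 * mu / V *
      ((\sum_(j < nl) ql j t * Tl j t) - (\sum_(k < nr) qr k t * T t))
    /\
    T^`() t = Rs * T t * z0 / (p t * V * cv) *
      ((\sum_(j < nl) ql j t * (cp * Tl j t - cv * T t))
       - Rs * T t * (\sum_(k < nr) qr k t)).
Proof.
(* The gas equation makes [p] a constant multiple of the internal energy
   [m * cv * T] on [I]; the formula for [T'] comes from the product rule. *)
move=> t It.
have mcvD : derivable (fun s => m s * cv) t 1.
  by apply: derivableM; [exact: m_diff|exact: derivable_cst].
have mcvTD : derivable (fun s => m s * cv * T s) t 1.
  by apply: derivableM; last exact: T_diff.
have V0 : V != 0 by rewrite gt_eqF.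
have cv0 : cv != 0 by rewrite gt_eqF.
have Rs0 : Rs != 0 by rewrite gt_eqF.
have z00 : z0 != 0 by rewrite gt_eqF.
have m0 : m t != 0 by rewrite gt_eqF ?m_gt0.
have T0 : T t != 0 by rewrite gt_eqF ?T_gt0.
have dE : (fun s => m s * cv * T s)^`() t =
    cv * ('D_1 m t * T t + m t * 'D_1 T t).
  rewrite derive1E (deriveM (f := fun s => m s * cv)) //; last exact: T_diff.
  rewrite (deriveM (f := m) (g := cst cv)) ?derive_cst //; last exact: m_diff.
  by rewrite /GRing.scale /=; ring.
split.
  (* The gas equation holds only on [I]; since [I] is open this gives equality near [t], enough to
     equate derivatives. *)
  have pE : {near t, p =1 (Rs * z0 / (V * cv)) \*: (fun s => m s * cv * T s)}.
    near=> s.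
    have Is : I s by near: s; exact: open_nbhs_nbhs.
    apply: (mulIf V0); rewrite gas_equation //= -[_ *: _]/(_ * _); field.
    by rewrite V0 cv0.
  rewrite derive1E (near_eq_derive _ pE) deriveZ //.
  rewrite -derive1E energy_balance // -mulr_suml muE -[_ *: _]/(_ * _); field.
  by rewrite V0 cv0.
(* Splits the inlet sum into the enthalpy inflow of the energy balance and the total inflow of the
   mass balance. *)
have sumE : \sum_(j < nl) ql j t * (cp * Tl j t - cv * T t) =
    cp * (\sum_(j < nl) ql j t * Tl j t) - cv * T t * \sum_(j < nl) ql j t.
  rewrite !mulr_sumr -sumrB; apply: eq_bigr => j _; ring.
(* With [p t * V] replaced, the prefactor is [1 / (m t * cv)] up to cancellation, the factor
   obtained by solving [dE] for [T']. *)
rewrite sumE gas_equation //.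
have dTE : T^`() t =
    ((fun s => m s * cv * T s)^`()%classic t - cv * T t * 'D_1 m t) / (m t * cv).
  by rewrite dE derive1E; field; rewrite m0 cv0.
(* The outlet terms combine to [-(cp - cv) * T t], hence [Rs] is expanded as [cp - cv]; the side
   condition [cp - cv != 0] is then folded back to [Rs != 0]. *)
rewrite dTE energy_balance // -derive1E mass_balance // -cpBcv; field.
by rewrite ?cpBcv m0 cv0 T0 Rs0 z00.
Unshelve. all: by end_near.
Qed.
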